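(* Let $X$ be a finite-dimensional real Banach space with $\dim X\ge 2$. Then for every $\lambda\in[0,1]$ there exist $x_0,y_0\in S_X$ with $x_0\perp_B y_0$ such that $$J_\lambda^\perp(X)=\min\{\|\lambda x_0+(1-\lambda)y_0\|,\ \|\lambda x_0-(1-\lambda)y_0\|\}.$$
   Context: For a real Banach space $X$, $S_X=\{x\in X:\|x\|=1\}$. For $x,y\in X$, $x\perp_B y$ (Birkhoff--James orthogonality) means $\|x\|\le\|x+ty\|$ for every $t\in\mathbb R$. For $\lambda\in[0,1]$, $$J_\lambda^\perp(X)=\sup\{\min\{\|\lambda x+(1-\lambda)y\|,\|\lambda x-(1-\lambda)y\|\}: x,y\in S_X,\ x\perp_B y\}.$$ *)

(* Defs.v *)
From HB Require Import structures.
From mathcomp Require Import all_boot all_order all_algebra.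
From mathcomp Require Import all_classical all_reals all_analysis.
Set Implicit Arguments.
Unset Strict Implicit.
Unset Printing Implicit Defensive.

Import Order.TTheory GRing.Theory Num.Theory.
Import numFieldNormedType.Exports.
Local Open Scope classical_set_scope.
Local Open Scope ring_scope.

(* The norm need not be related to the coordinates supplied by the vectType
   structure; the two structures only share the underlying module. *)
#[short(type="finDimBanachType")]
HB.structure Definition FinDimBanach (R : realType) :=
  {X of CompleteNormedModule R X & Vector R X}.

Definition unit_sphere (R : realType) (X : normedModType R) : set X :=
  [set x | `|x| = 1].
Arguments unit_sphere {R} X _.

Definition bj_orthogonal (R : realType) (X : normedModType R) (x y : X) : Prop :=
  forall t : R, `|x| <= `|x + t *: y|.

(* [sup] is the real-valued supremum, whose value is a default one when the set
   is empty or unbounded.  For 0 <= lambda <= 1 the set is bounded by 1; it is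
   nonempty as soon as dim X >= 2. *)
Definition J_perp (R : realType) (X : normedModType R) (lambda : R) : R :=
  sup [set r : R | exists x y : X,
    [/\ unit_sphere X x, unit_sphere X y, bj_orthogonal x y &
        r = Num.min `|lambda *: x + (1 - lambda) *: y|
                    `|lambda *: x - (1 - lambda) *: y|]].

Arguments J_perp {R} X lambda.

(* Main.v *)
Require Import Defs.
From HB Require Import structures.
From mathcomp Require Import all_boot all_order all_algebra.
From mathcomp Require Import all_classical all_reals all_analysis.
Import Order.TTheory GRing.Theory Num.Theory.
Import numFieldNormedType.Exports.
Local Open Scope classical_set_scope.
Local Open Scope ring_scope.

(** The supremum is a maximum by compactness.  The pairs (x, y) of unit vectors
with x Birkhoff-James orthogonal to y form a closed subset of X * X, because
orthogonality is an intersection of closed conditions |x| <= |x + t y|, one for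
each real t ([closed_bj_sphere_pairs]).  They lie in the square of the closed
unit ball, which is compact in finite dimension ([compact_unit_ball]), and
(x, y) |-> min |lambda x +/- (1 - lambda) y| is continuous, so it attains a
maximum there as soon as there is one such pair; this maximum is J_perp.

Compactness of the unit ball is transported from Heine-Borel in R^n along a
coordinate isomorphism f : R^n -> X.  A linear map out of R^n is continuous for
any norm on the target ([linear_rV_continuous]); when it is injective, |f u|
has a positive minimum on the unit sphere of R^n
([injective_linear_rV_bounded_below]), so the preimage of the ball is bounded.

A pair exists because dim X >= 2 ([bj_sphere_pairs_nonempty]): for a unit vector
u and a vector v off the line of u, the point of v + R u that is nearest to 0 is
nonzero and, by minimality, orthogonal to u; it remains to normalise it. *)

Lemma normalize_unit_sphere (R : realType) (X : normedModType R) (x : X) :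
  x != 0 -> unit_sphere X (`|x|^-1 *: x).
Proof.
by move=> x0; rewrite /unit_sphere/= normrZ normfV normr_id mulVf// normr_eq0.
Qed.

Lemma linear_rV_continuous (R : realType) (n : nat) (X : normedModType R)
    (f : {linear 'rV[R]_n -> X}) : continuous f.
Proof.
have -> : (f : 'rV[R]_n -> X) =
    (fun u => \sum_(i < n) u ord0 i *: f (delta_mx 0 i)).
  apply/funext => u; rewrite {1}(row_sum_delta u) linear_sum.
  by apply: eq_bigr => i _; rewrite linearZ.
apply: continuous_big => [|i _ u]; first exact: add_continuous.
exact: cvgZr_tmp (@coord_continuous _ _ _ ord0 i u).
Qed.

(** By homogeneity the best constant is the minimum of |f u| on the unit sphere,
which is attained by compactness and is nonzero by injectivity. *)
Lemma injective_linear_rV_bounded_below (R : realType) (n : nat)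
    (X : normedModType R) (f : {linear 'rV[R]_n -> X}) : injective f ->
  exists2 c : R, 0 < c & forall u, c * `|u| <= `|f u|.
Proof.
move=> finj.
pose S := unit_sphere 'rV[R]_n.
have SP (u : 'rV[R]_n) : u != 0 -> S (`|u|^-1 *: u).
  exact: normalize_unit_sphere.
(* The sphere is empty exactly when n = 0, and then 0 is the only vector. *)
have [S0|Snonempty] := pselect (S !=set0); last first.
  exists 1 => // u; have [->|/SP Su] := eqVneq u 0.
    by rewrite normr0 mulr0 normr_ge0.
  by exfalso; apply: Snonempty; exists (`|u|^-1 *: u).
have Scompact : compact S.
  apply: bounded_closed_compact.
    exists 1; split; first exact: real1.
    by move=> M M1 u /= ->; exact: ltW.
  apply: (@closed_comp _ _ (fun u : 'rV[R]_n => `|u|) [set x | x = 1]).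
    by move=> u _; exact: norm_continuous.
  exact: closed_eq.
have fcont : {within S, continuous (fun u => `|f u|)}.
  apply: continuous_subspaceT => u.
  exact: cvg_norm (linear_rV_continuous R n X f u).
have [w /set_mem Sw wmin] := compact_EVT_min S0 Scompact fcont.
exists `|f w|.
  rewrite normr_gt0; apply/eqP; rewrite -(linear0 f) => /finj w0.
  by move/eqP: Sw; rewrite w0 normr0 eq_sym oner_eq0.
move=> u; have [->|u0] := eqVneq u 0; first by rewrite normr0 mulr0 normr_ge0.
have := wmin _ (mem_set (SP u u0)).
rewrite linearZ normrZ normfV normr_id mulrC ler_pdivlMr//.
by rewrite normr_gt0.
Qed.

(** Named so that linearity can be attached to it as a canonical instance. *)
Definition linear_combination (R : pzRingType) (X : lmodType R) (n : nat)
    (e : 'I_n -> X) (u : 'rV[R]_n) : X := \sum_(i < n) u ord0 i *: e i.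

Lemma linear_combination_is_linear (R : pzRingType) (X : lmodType R) (n : nat)
    (e : 'I_n -> X) : linear (linear_combination R X n e).
Proof.
move=> a u v; rewrite /linear_combination scaler_sumr -big_split.
by apply: eq_bigr => i _; rewrite !mxE scalerDl scalerA.
Qed.

HB.instance Definition _ (R : pzRingType) (X : lmodType R) (n : nat)
    (e : 'I_n -> X) :=
  GRing.isLinear.Build R 'rV[R]_n X *:%R (linear_combination R X n e)
    (linear_combination_is_linear R X n e).

(** The ball is the image under coordinates-to-vector, which is continuous, of a
closed set of coordinates that is bounded by the lower bound on |f u|. *)
Lemma compact_unit_ball (R : realType) (X : finDimBanachType R) :
  compact [set x : X | `|x| <= 1].
Proof.
pose e := vbasis {:X}.
pose f : {linear 'rV[R]_(\dim {:X}) -> X} :=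
  linear_combination R X _ (fun i => e`_i).
pose coords (x : X) : 'rV[R]_(\dim {:X}) := \row_i coord e i x.
have coordsK : cancel coords f.
  move=> x; rewrite [RHS](coord_vbasis (memvf x)).
  by apply: eq_bigr => i _; rewrite mxE.
have fK : cancel f coords.
  move=> u; apply/rowP => i; rewrite mxE.
  by rewrite (coord_sum_free _ _ (basis_free (vbasisP {:X}))).
have [c c0 cf] := injective_linear_rV_bounded_below _ _ X f (can_inj fK).
have fcont := linear_rV_continuous _ _ X f.
have -> : [set x : X | `|x| <= 1] = f @` [set u | `|f u| <= 1].
  apply/seteqP; split => [x x1|_ [u fu1 <-]//].
  by exists (coords x); rewrite /= coordsK.
apply: continuous_compact; first exact: continuous_subspaceT.
apply: bounded_closed_compact.
  exists c^-1; split; first exact: num_real.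
  move=> M /ltW cM u /= fu1; apply: le_trans cM.
  by rewrite -[c^-1]mul1r ler_pdivlMr// mulrC (le_trans (cf u)).
apply: (@closed_comp _ _ (fun u => `|f u|) [set x | x <= 1]);
  last exact: closed_le.
by move=> u _; exact: cvg_norm (fcont u).
Qed.

Definition bj_sphere_pairs (R : realType) (X : normedModType R) : set (X * X) :=
  [set p | [/\ unit_sphere X p.1, unit_sphere X p.2 & bj_orthogonal p.1 p.2]].

Lemma closed_le_continuous (R : realType) (T : topologicalType) (g h : T -> R) :
  continuous g -> continuous h -> closed [set x | g x <= h x].
Proof.
move=> gc hc.
have -> : [set x | g x <= h x] = (fun x => h x - g x) @^-1` [set r | 0 <= r].
  by apply/seteqP; split => x /=; rewrite subr_ge0.
apply: closed_comp; last exact: closed_ge.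
by move=> x _; apply: cvgB; [exact: hc|exact: gc].
Qed.

Lemma closed_bj_sphere_pairs (R : realType) (X : normedModType R) :
  closed (bj_sphere_pairs R X).
Proof.
have fstc : continuous (fun p : X * X => `|p.1|).
  by move=> p; apply: cvg_norm; exact: cvg_fst.
have sndc : continuous (fun p : X * X => `|p.2|).
  by move=> p; apply: cvg_norm; exact: cvg_snd.
have -> : bj_sphere_pairs R X =
    ((fun p : X * X => `|p.1|) @^-1` [set r | r = 1]) `&`
    (((fun p : X * X => `|p.2|) @^-1` [set r | r = 1]) `&`
    \bigcap_(t in [set: R]) [set p : X * X | `|p.1| <= `|p.1 + t *: p.2| ]).
  apply/seteqP; split => p.
    by case=> p1 p2 p12; split => //; split => // t _; exact: p12.
  by case=> p1 [p2 p12]; split => // t; exact: p12.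
apply: closedI.
  apply: closed_comp; last exact: closed_eq.
  by move=> p _; exact: fstc.
apply: closedI.
  apply: closed_comp; last exact: closed_eq.
  by move=> p _; exact: sndc.
apply: closed_bigI => t _; apply: closed_le_continuous => // p.
apply: cvg_norm; apply: cvgD; first exact: cvg_fst.
by apply: cvgZl_tmp; exact: cvg_snd.
Qed.

Lemma compact_bj_sphere_pairs (R : realType) (X : finDimBanachType R) :
  compact (bj_sphere_pairs R X).
Proof.
apply: subclosed_compact (closed_bj_sphere_pairs R X)
  (compact_setX (compact_unit_ball R X) (compact_unit_ball R X)) _.
by move=> p [p1 p2 _]; split; rewrite /= ?p1 ?p2.
Qed.

(** The point of the line v + R u nearest to 0 works: being orthogonal to u says
precisely that no translation along u decreases the norm. *)
Lemma exists_bj_orthogonal_translate (R : realType) (X : normedModType R)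
    (u v : X) : `|u| = 1 -> exists t : R, bj_orthogonal (v + t *: u) u.
Proof.
move=> u1; pose phi (t : R) := `|v + t *: u|.
have phic : continuous phi.
  move=> t; apply: cvg_norm; apply: cvgD; first exact: cvg_cst.
  by apply: cvgZr_tmp; exact: cvg_id.
(* Beyond |t| = 2|v| one has |v + t u| >= |t| - |v| >= |v|, the value at t = 0,
   so it is enough to minimise over a segment. *)
pose M := 2 * `|v|.
have M0 : 0 <= M by rewrite mulr_ge0.
have [|t0 _ t0min] := @EVT_min _ phi (- M) M _ (continuous_subspaceT phic).
  by rewrite (le_trans _ M0)// oppr_le0.
have phi_min t : phi t0 <= phi t.
  have [tM|tM] := boolP (t \in `[- M, M]%R); first exact: t0min.
  apply: (@le_trans _ _ (phi 0)).
    by apply: t0min; rewrite in_itv/= oppr_le0 M0.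
  have {}tM : M < `|t| by move: tM; rewrite in_itv/= -ler_norml -ltNge.
  rewrite /phi scale0r addr0 -(lerD2r `|v|) -mulr2n -mulr_natl.
  apply: (le_trans (ltW tM)); rewrite -[leLHS]mulr1 -u1 -normrZ.
  by rewrite -[in leLHS](addKr v (t *: u)) addrC (le_trans (ler_normB _ _)).
by exists t0 => s; rewrite -addrA -scalerDl; exact: phi_min.
Qed.

Lemma bj_orthogonalZl (R : realType) (X : normedModType R) (a : R) (x y : X) :
  a != 0 -> bj_orthogonal x y -> bj_orthogonal (a *: x) y.
Proof.
move=> a0 xy t.
have -> : a *: x + t *: y = a *: (x + (a^-1 * t) *: y).
  by rewrite scalerDr scalerA mulrA divff// mul1r.
by rewrite !normrZ ler_wpM2l.
Qed.

Lemma bj_sphere_pairs_nonempty (R : realType) (X : finDimBanachType R) :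
  (2 <= \dim {:X})%N -> bj_sphere_pairs R X !=set0.
Proof.
move=> hdim.
have not_line (x : X) : ~~ ({:X} <= <[x]>)%VS.
  apply/negP => /dimvS; rewrite dim_vline => /(leq_trans hdim).
  by case: (x != 0).
have x0 : vpick {:X} != 0.
  rewrite vpick0 -dimv_eq0 -lt0n; exact: leq_trans hdim.
set u := `|vpick {:X}|^-1 *: vpick {:X}.
have u1 : unit_sphere X u by exact: normalize_unit_sphere.
have /subvPn [v _ vu] := not_line u.
have [t tu] := exists_bj_orthogonal_translate R X u v u1.
have w0 : v + t *: u != 0.
  apply: contraNneq vu => /eqP; rewrite addr_eq0 => /eqP ->.
  by rewrite memvN memvZ// memv_line.
exists (`|v + t *: u|^-1 *: (v + t *: u), u); split => //=.
  exact: normalize_unit_sphere.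
by apply: bj_orthogonalZl => //; rewrite invr_eq0 normr_eq0.
Qed.

Theorem proposition2p6 (R : realType) (X : finDimBanachType R)
    (hdim : (2 <= \dim {:X})%N) (lambda : R) (hlambda : 0 <= lambda <= 1) :
  exists x0 y0 : X,
    [/\ unit_sphere X x0, unit_sphere X y0, bj_orthogonal x0 y0 &
        J_perp X lambda =
          Num.min `|lambda *: x0 + (1 - lambda) *: y0|
                  `|lambda *: x0 - (1 - lambda) *: y0|].
Proof.
pose plus (p : X * X) : R := `|lambda *: p.1 + (1 - lambda) *: p.2|.
pose minus (p : X * X) : R := `|lambda *: p.1 - (1 - lambda) *: p.2|.
pose F := plus \min minus.
have Fc : continuous F.
  have fstZ a : continuous (fun p : X * X => a *: p.1).
    by move=> p; apply: cvgZl_tmp; exact: cvg_fst.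
  have sndZ a : continuous (fun p : X * X => a *: p.2).
    by move=> p; apply: cvgZl_tmp; exact: cvg_snd.
  have plusc : continuous plus.
    by move=> p; exact: cvg_norm (cvgD (fstZ _ p) (sndZ _ p)).
  have minusc : continuous minus.
    by move=> p; exact: cvg_norm (cvgB (fstZ _ p) (sndZ _ p)).
  by move=> p; exact: continuous_min (plusc p) (minusc p).
have [[x0 y0] /set_mem[x1 y1 xy] Fmax] := compact_EVT_max
  (bj_sphere_pairs_nonempty R X hdim) (compact_bj_sphere_pairs R X)
  (continuous_subspaceT Fc).
exists x0, y0; split => //.
apply/eqP; rewrite eq_le; apply/andP; split.
  apply: ge_sup; first by exists (F (x0, y0)), x0, y0.
  move=> _ [x [y [hx hy hxy ->]]].
  by apply: (Fmax (x, y)); exact: mem_set.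
apply: ub_le_sup; last by exists x0, y0.
exists (F (x0, y0)) => _ [x [y [hx hy hxy ->]]].
by apply: (Fmax (x, y)); exact: mem_set.
Qed.
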